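(* In each of the two cases (Case 1 and Case 2 described in the context, with the corresponding $\alpha_0$ and $C$), for each $\alpha\in(0,\alpha_0]$ there exists a unique fixed point $w^\alpha\in\mathbb{R}^{nd}$ of $T_\alpha$. In addition, the fixed points are uniformly bounded: $$\sup_{\alpha\in(0,\alpha_0]}\|w^\alpha\|_{\pi\otimes1_d}\le R,\qquad R=\frac1C\|J(\nabla F(0))\|_{\pi\otimes1_d}.$$
   Context: Network: $G=(V,E)$ is a strongly connected directed graph on $V=\{1,\dots,n\}$. $W=(W_{ij})$ is a real nonnegative $n\times n$ matrix with $W_{ij}>0$ if $(i,j)\in E$ or $i=j$, and $W_{ij}=0$ otherwise; $W$ is column stochastic, $\sum_{k=1}^n W_{kj}=1$ for all $j$. $\pi=(\pi_1,\dots,\pi_n)^\top$ is the right eigenvector of $W$ with $W\pi=\pi$ and $\sum_j\pi_j=1$ (all $\pi_j>0$). A function is $L$-smooth if it is differentiable with $L$-Lipschitz gradient. For $w=(w_1^\top,\dots,w_n^\top)^\top\in\mathbb{R}^{nd}$ with $w_j\in\mathbb{R}^d$: $\|w\|_{\pi\otimes1_d}=\big(\sum_{j}\frac1{\pi_j}\|w_j\|^2\big)^{1/2}$; $\nabla F(w)=(\nabla f_1(w_1)^\top,\dots,\nabla f_n(w_n)^\top)^\top$; $J(w)\in\mathbb{R}^{nd}$ has $k$-th block $\sum_{j=1}^nW_{kj}w_j$; $T_\alpha(w)\in\mathbb{R}^{nd}$ has $k$-th block $\sum_{j=1}^nW_{kj}\big(w_j-\alpha\nabla f_j(\frac{w_j}{n\pi_j})\big)$.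 Case 1: for each $1\le k\le n$, $f_k:\mathbb{R}^d\to\mathbb{R}$ is $\mu_k$-strongly convex ($\mu_k>0$) and $L_k$-smooth; $\alpha_0=\min_k\frac{2n\pi_k}{L_k+\mu_k}$ and $C=\min_k\frac{\mu_kL_k}{n(\mu_k+L_k)\pi_k}$. Case 2: $f_k(x)=\frac12x^\top A_kx+B_kx$ with $A_k\in\mathbb{R}^{d\times d}$ symmetric positive semidefinite and $B_k\in\mathbb{R}^{1\times d}$, and $f=\frac1n\sum_kf_k$ is $\mu$-strongly convex for some $\mu>0$; $L_k$ is the largest eigenvalue of $A_k$, $\alpha_0=\min_k\frac{2n\pi_k}{L_k+\epsilon}$ for a fixed arbitrary $\epsilon>0$, and $C=\frac{1-\eta_\epsilon}{\alpha_0}$, where $\eta_\epsilon\in(0,1)$ is a contraction constant of $T_{\alpha_0}$, i.e. $\|T_{\alpha_0}(x)-T_{\alpha_0}(y)\|_{\pi\otimes1_d}\le\eta_\epsilon\|x-y\|_{\pi\otimes1_d}$ for all $x,y$ (such a constant exists). *)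

(* Defs.v *)
From mathcomp Require Import all_boot all_order all_algebra.
From mathcomp Require Import all_classical all_reals ereal topology normedtype.
From mathcomp Require Import derive.
Import Order.TTheory GRing.Theory Num.Theory.
Import numFieldNormedType.Exports.

Set Implicit Arguments.
Unset Strict Implicit.
Unset Printing Implicit Defensive.

Local Open Scope classical_set_scope.
Local Open Scope ring_scope.

(* The n.+1 agents are indexed by 'I_n.+1, so that there is at least one of
   them; R^(d+1) is the type of column vectors, and a stacked vector
   w = (w_1, ..., w_n) is the matrix whose column j is the block w_j. *)

Definition min_ord (R : realType) (n : nat) (g : 'I_n.+1 -> R) : R :=
  \big[Num.min/g ord0]_k g k.

(* The library's norm on matrices is the sup norm. *)
Definition enorm (R : realType) (d : nat) (x : 'cV[R]_d.+1) : R :=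
  Num.sqrt (\sum_i x i 0 ^+ 2).

Definition grad (R : realType) (d : nat) (f : 'cV[R]_d.+1 -> R)
    (x : 'cV[R]_d.+1) : 'cV[R]_d.+1 :=
  \col_i 'D_(delta_mx i 0) f x.

Definition smooth (R : realType) (d : nat) (L : R) (f : 'cV[R]_d.+1 -> R) :
    Prop :=
  (forall x, differentiable f x) /\
  (forall x y, enorm (grad f x - grad f y) <= L * enorm (x - y)).

Definition strongly_convex (R : realType) (d : nat) (mu : R)
    (f : 'cV[R]_d.+1 -> R) : Prop :=
  forall (x y : 'cV[R]_d.+1) (t : R), 0 <= t <= 1 ->
    f (t *: x + (1 - t) *: y) <=
      t * f x + (1 - t) * f y - mu / 2 * t * (1 - t) * enorm (x - y) ^+ 2.

Definition quad (R : realType) (d : nat) (A : 'M[R]_d.+1) (B : 'rV[R]_d.+1)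
    (x : 'cV[R]_d.+1) : R :=
  2^-1 * (x^T *m A *m x) 0 0 + (B *m x) 0 0.

Definition possemidef (R : realType) (d : nat) (A : 'M[R]_d.+1) : Prop :=
  forall x : 'cV[R]_d.+1, 0 <= (x^T *m A *m x) 0 0.

Definition largest_eigenvalue (R : realType) (d : nat) (A : 'M[R]_d.+1)
    (l : R) : Prop :=
  eigenvalue A l /\ (forall a, eigenvalue A a -> a <= l).

Definition average (R : realType) (n d : nat)
    (f : 'I_n.+1 -> 'cV[R]_d.+1 -> R) (x : 'cV[R]_d.+1) : R :=
  n.+1%:R^-1 * \sum_k f k x.

Definition strongly_connected (n : nat) (E : rel 'I_n.+1) : Prop :=
  forall i j, connect E i j.

Definition mixing_matrix (R : realType) (n : nat) (E : rel 'I_n.+1)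
    (W : 'M[R]_n.+1) : Prop :=
  [/\ forall i j, E i j || (i == j) -> 0 < W i j,
      forall i j, ~~ (E i j || (i == j)) -> W i j = 0
    & forall j, \sum_k W k j = 1].

(* Positivity of the entries of pi is a consequence when E is strongly
   connected. *)
Definition stationary (R : realType) (n : nat) (W : 'M[R]_n.+1)
    (pi : 'cV[R]_n.+1) : Prop :=
  W *m pi = pi /\ \sum_j pi j 0 = 1.

Definition wnorm (R : realType) (n d : nat) (pi : 'cV[R]_n.+1)
    (w : 'M[R]_(d.+1, n.+1)) : R :=
  Num.sqrt (\sum_j (pi j 0)^-1 * enorm (col j w) ^+ 2).

Definition gradF (R : realType) (n d : nat) (f : 'I_n.+1 -> 'cV[R]_d.+1 -> R)
    (w : 'M[R]_(d.+1, n.+1)) : 'M[R]_(d.+1, n.+1) :=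
  \matrix_(i, k) grad (f k) (col k w) i 0.

Definition mix (R : realType) (n d : nat) (W : 'M[R]_n.+1)
    (w : 'M[R]_(d.+1, n.+1)) : 'M[R]_(d.+1, n.+1) :=
  \matrix_(i, k) (\sum_j W k j *: col j w) i 0.

Definition Tstep (R : realType) (n d : nat) (W : 'M[R]_n.+1)
    (pi : 'cV[R]_n.+1) (f : 'I_n.+1 -> 'cV[R]_d.+1 -> R) (alpha : R)
    (w : 'M[R]_(d.+1, n.+1)) : 'M[R]_(d.+1, n.+1) :=
  \matrix_(i, k)
    (\sum_j W k j *: (col j w -
       alpha *: grad (f j) ((n.+1%:R * pi j 0)^-1 *: col j w))) i 0.

Definition contraction_constant (R : realType) (n d : nat)
    (pi : 'cV[R]_n.+1) (T : 'M[R]_(d.+1, n.+1) -> 'M[R]_(d.+1, n.+1))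
    (eta : R) : Prop :=
  0 < eta < 1 /\ (forall x y, wnorm pi (T x - T y) <= eta * wnorm pi (x - y)).

Definition unique_fixed_points (R : realType) (n d : nat)
    (T : R -> 'M[R]_(d.+1, n.+1) -> 'M[R]_(d.+1, n.+1)) (alpha0 : R) : Prop :=
  forall alpha, 0 < alpha <= alpha0 -> exists! w, T alpha w = w.

(* The supremum is taken in the extended reals, where it is always
   meaningful. *)
Definition fixed_points_bounded (R : realType) (n d : nat)
    (pi : 'cV[R]_n.+1)
    (T : R -> 'M[R]_(d.+1, n.+1) -> 'M[R]_(d.+1, n.+1)) (alpha0 r : R) :
    Prop :=
  forall w : R -> 'M[R]_(d.+1, n.+1),
    (forall alpha, 0 < alpha <= alpha0 -> T alpha (w alpha) = w alpha) ->
    (ereal_sup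
       [set (wnorm pi (w alpha))%:E | alpha in
         [set a : R | (0 < a <= alpha0)%R]] <= r%:E)%E.

(* Main.v *)
From HB Require Import structures.
Require Import Defs.
From mathcomp Require Import all_boot all_order all_algebra.
From mathcomp Require Import all_classical all_reals ereal topology normedtype.
From mathcomp Require Import sequences derive ring lra.
Import Order.TTheory GRing.Theory Num.Theory.
Import numFieldNormedType.Exports.
Local Open Scope ring_scope.

Set Implicit Arguments.
Unset Strict Implicit.
Unset Printing Implicit Defensive.

(** With q_alpha the map that performs the gradient steps of all the agents,
    T_alpha = J o q_alpha, where J is the mixing. Jensen's inequality, with the
    weights W k j * pi j / pi k, shows that J does not increase the weighted
    norm ([wnorm_mix_le]). Suppose that T_alpha is a contraction of constant
    1 - alpha * C for that norm. Then Banach's theorem yields the fixed point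
    ([wnorm_contraction_fixpoint]), and since T_alpha 0 = - alpha J (grad F 0),
    the triangle inequality
      |w| <= |T_alpha w - T_alpha 0| + |T_alpha 0|
          <= (1 - alpha C) |w| + alpha |J (grad F 0)|
    is the announced bound ([contractive_family]). What remains is the
    contraction estimate.

    In the strongly convex case each gradient step contracts by itself. This
    follows from
      mu L |y - x|^2 + |grad f y - grad f x|^2
        <= (L + mu) <grad f y - grad f x, y - x>
    ([strongly_convex_smooth_cocoercive]), which comes from the descent lemma
    and the first-order form of strong convexity.

    In the quadratic case it is enough to contract at alpha0, because T_alpha
    is a barycentre of J and T_{alpha0} ([Tstep_convex]). The linear part of
    T_{alpha0} does not increase the norm, by the inequality
    |A x|^2 <= L <A x, x> for the largest eigenvalue L of A ([sqr_mulmx_le]).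
    If it preserves the norm of w, then A_j w_j = 0 for all j and, the network
    being strongly connected, w_j = pi_j u for a single u
    ([mix_isometric_consensus]); so u is in the kernel of all the A_j, and
    u = 0 by strong convexity of the average. The ratio of the two squared
    norms is thus below 1 away from 0, and it attains its maximum
    ([psd_rayleigh]), which provides the contraction constant. *)

(** * Positive semidefinite symmetric bilinear forms *)

(** A symmetric bilinear form on a real vector space, nonnegative on the
    diagonal. *)
Record psd_form (R : realType) (V : lmodType R) (b : V -> V -> R) : Prop :=
  PsdForm {
    psd_sym : forall x y, b x y = b y x;
    psd_linear : forall a x y z, b (a *: x + y) z = a * b x z + b y z;
    psd_ge0 : forall x, 0 <= b x x }.

Section PsdTheory.
Variables (R : realType) (V : lmodType R) (b : V -> V -> R).
Hypothesis hb : psd_form b.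

Lemma psdDl x y z : b (x + y) z = b x z + b y z.
Proof. by rewrite -[x]scale1r (psd_linear hb) mul1r scale1r. Qed.

Lemma psd0l z : b 0 z = 0.
Proof. by apply: (addrI (b 0 z)); rewrite -psdDl !addr0. Qed.

Lemma psdZl a x z : b (a *: x) z = a * b x z.
Proof. by rewrite -[a *: x]addr0 (psd_linear hb) psd0l addr0. Qed.

Lemma psdNl x z : b (- x) z = - b x z.
Proof. by rewrite -scaleN1r psdZl mulN1r. Qed.

Lemma psdDr x y z : b z (x + y) = b z x + b z y.
Proof. by rewrite !(psd_sym hb z) psdDl. Qed.

Lemma psdZr a x z : b z (a *: x) = a * b z x.
Proof. by rewrite !(psd_sym hb z) psdZl. Qed.

Lemma psdNr x z : b z (- x) = - b z x.
Proof. by rewrite !(psd_sym hb z) psdNl. Qed.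

Lemma psd_sq a x : b (a *: x) (a *: x) = a ^+ 2 * b x x.
Proof. by rewrite psdZl psdZr mulrA expr2. Qed.

Lemma psdDsq x y : b (x + y) (x + y) = b x x + 2 * b x y + b y y.
Proof. by rewrite !psdDl !psdDr (psd_sym hb y x); ring. Qed.

Lemma psdBsq x y : b (x - y) (x - y) = b x x - 2 * b x y + b y y.
Proof. by rewrite psdDsq psdNl !psdNr; ring. Qed.

Lemma psd_Cauchy_Schwarz x y : b x y ^+ 2 <= b x x * b y y.
Proof.
have H t : 0 <= b x x - 2 * t * b x y + t ^+ 2 * b y y.
  by have := psd_ge0 hb (x - t *: y); rewrite psdBsq psd_sq psdZr mulrA.
have := psd_ge0 hb y; rewrite le_eqVlt => /predU1P[y0|y0].
  have [->|xy0] := eqVneq (b x y) 0.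
    by rewrite expr0n mulr_ge0// psd_ge0.
  (* for y isotropic, H is affine in t; it would be -1 at the following t *)
  have := H ((b x x + 1) / (2 * b x y)).
  rewrite -y0 mulr0 addr0.
  have -> : 2 * ((b x x + 1) / (2 * b x y)) * b x y = b x x + 1.
    by field.
  by rewrite opprD addrA subrr sub0r oppr_ge0 ler10.
have := H (b x y / b y y).
have -> : b x x - 2 * (b x y / b y y) * b x y + (b x y / b y y) ^+ 2 * b y y =
  (b x x * b y y - b x y ^+ 2) / b y y by field; rewrite gt_eqF.
by rewrite pmulr_lge0 ?invr_gt0// subr_ge0.
Qed.

(** The diagonal kernel of the form is its radical. *)
Lemma psd_kernel x y : b x x = 0 -> b x y = 0.
Proof.
move=> x0; have := psd_Cauchy_Schwarz x y; rewrite x0 mul0r => h.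
by apply/eqP; rewrite -sqrf_eq0 eq_le h sqr_ge0.
Qed.

Lemma psd_le_norms x y : b x y <= Num.sqrt (b x x) * Num.sqrt (b y y).
Proof.
rewrite -sqrtrM ?psd_ge0//; apply: (le_trans (ler_norm _)).
by rewrite -sqrtr_sqr ler_wsqrtr// psd_Cauchy_Schwarz.
Qed.

Lemma psd_triangle x y :
  Num.sqrt (b (x + y) (x + y)) <= Num.sqrt (b x x) + Num.sqrt (b y y).
Proof.
have s0 : 0 <= Num.sqrt (b x x) + Num.sqrt (b y y).
  by rewrite addr_ge0// sqrtr_ge0.
rewrite -(ler_pXn2r (_ : 0 < 2)%N)// ?nnegrE ?sqrtr_ge0//.
rewrite sqr_sqrtr ?psd_ge0// psdDsq sqrrD !sqr_sqrtr ?psd_ge0//.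
by rewrite lerD2r lerD2l mulr_natl lerMn2r psd_le_norms.
Qed.

End PsdTheory.

(** The pull-back of a form along a linear map. *)
Lemma psd_form_comp (R : realType) (U V : lmodType R) (b : V -> V -> R)
    (g : U -> V) : (forall a x y, g (a *: x + y) = a *: g x + g y) ->
  psd_form b -> psd_form (fun x y => b (g x) (g y)).
Proof.
move=> hg hb; split=> [x y|a x y z|x]; first exact: psd_sym.
  by rewrite hg (psd_linear hb).
exact: psd_ge0.
Qed.

Lemma psd_form_sum (R : realType) (I : finType) (V : lmodType R) (c : I -> R)
    (b : I -> V -> V -> R) : (forall i, 0 <= c i) ->
  (forall i, psd_form (b i)) ->
  psd_form (fun x y => \sum_i c i * b i x y).
Proof.
move=> c0 hb; split=> [x y|a x y z|x].
- by apply: eq_bigr => i _; rewrite (psd_sym (hb i)).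
- rewrite mulr_sumr -big_split/=; apply: eq_bigr => i _.
  by rewrite (psd_linear (hb i)) mulrDr mulrCA.
- by apply: sumr_ge0 => i _; rewrite mulr_ge0// (psd_ge0 (hb i)).
Qed.

Lemma psd_form_continuous_row (R : realType) p
    (b : 'rV[R]_p -> 'rV[R]_p -> R) : psd_form b ->
  continuous (fun x => b x x).
Proof.
move=> hb.
have bE x : b x x =
    \sum_j \sum_k x 0 j * (x 0 k * b (delta_mx 0 j) (delta_mx 0 k)).
  have bl (y z : 'rV[R]_p) : b y z = \sum_j y 0 j * b (delta_mx 0 j) z.
    rewrite {1}[y]row_sum_delta.
    elim/big_rec2: _ => [|j u v _ <-]; first exact: (psd0l hb).
    by rewrite (psd_linear hb).
  rewrite bl; apply: eq_bigr => j _; rewrite (psd_sym hb) bl mulr_sumr.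
  by apply: eq_bigr => k _; rewrite (psd_sym hb).
have -> : (fun x => b x x) = fun x =>
    \sum_j \sum_k x 0 j * (x 0 k * b (delta_mx 0 j) (delta_mx 0 k)).
  exact/funext/bE.
have ct (j : 'I_p) : continuous (fun x : 'rV[R]_p => x 0 j).
  exact: coord_continuous.
apply: continuous_big => [|j _]; first exact: add_continuous.
apply: continuous_big => [|k _ x]; first exact: add_continuous.
exact: continuousM (ct j x) (continuousM (ct k x) (@cst_continuous _ _ _ _)).
Qed.

Lemma psd_rayleigh_row (R : realType) p (q N : 'rV[R]_p.+1 -> 'rV[R]_p.+1 -> R) :
  psd_form q -> psd_form N -> (forall x, x != 0 -> 0 < N x x) ->
  exists2 v, v != 0 & forall x, q x x * N v v <= q v v * N x x.
Proof.
move=> hq hN N0; pose S := [set x : 'rV[R]_p.+1 | `|x| = 1]%classic.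
have S_neq0 x : S x -> x != 0.
  by move=> Sx; rewrite -normr_eq0 Sx oner_eq0.
have S_normed (x : 'rV[R]_p.+1) : x != 0 -> S (`|x|^-1 *: x).
  move=> x0; rewrite /S/= normrZ ger0_norm ?invr_ge0//.
  by rewrite mulVf ?normr_eq0.
have cS : compact S.
  apply: bounded_closed_compact.
    by exists 1; split => // M M1 x; rewrite /S/= => ->; exact: ltW.
  apply: (@closed_comp _ _ (fun x : 'rV[R]_p.+1 => `|x|) [set 1]%classic).
    by move=> x _; exact: norm_continuous.
  exact: closed_eq.
have [||v] := @EVT_max_rV R _ (fun x => q x x / N x x) S _ cS.
- by exists (`|const_mx 1 : 'rV[R]_p.+1|^-1 *: const_mx 1); apply: S_normed;
    apply/eqP => /rowP/(_ 0); rewrite !mxE; exact/eqP/oner_neq0.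
- apply/continuous_in_subspaceT => x /set_mem Sx.
  have Nx : N x x != 0 by rewrite gt_eqF// N0// S_neq0.
  exact: continuousM (@psd_form_continuous_row _ _ _ hq x)
    (continuousV Nx (@psd_form_continuous_row _ _ _ hN x)).
move=> /set_mem Sv vmax; exists v => [|x]; first exact: S_neq0.
have [->|x0] := eqVneq x 0; first by rewrite (psd0l hq) (psd0l hN) mul0r mulr0.
have := vmax _ (mem_set (S_normed x x0)).
rewrite (psd_sq hq) (psd_sq hN) -mulf_div divff; last first.
  by rewrite sqrf_eq0 invr_eq0 normr_eq0.
rewrite mul1r.
by rewrite ler_pdivrMr ?N0// mulrAC ler_pdivlMr ?N0// S_neq0.
Qed.

(** The ratio of two quadratic forms, the second one being definite, attains
    its maximum: this is the source of all the compactness in the argument. *)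
Lemma psd_rayleigh (R : realType) m n
    (q N : 'M[R]_(m.+1, n.+1) -> 'M[R]_(m.+1, n.+1) -> R) :
  psd_form q -> psd_form N -> (forall x, x != 0 -> 0 < N x x) ->
  exists2 v, v != 0 & forall x, q x x * N v v <= q v v * N x x.
Proof.
move=> hq hN N0; pose g (u : 'rV[R]_(m.+1 * n.+1)) := vec_mx u : 'M_(m.+1, n.+1).
have gl a x y : g (a *: x + y) = a *: g x + g y by rewrite /g linearP.
have [|v v0 vmax] := @psd_rayleigh_row R (n + m * n.+1)%N _ _
  (psd_form_comp gl hq) (psd_form_comp gl hN).
  by move=> x x0; apply: N0; rewrite /g vec_mx_eq0.
exists (g v) => [|x]; first by rewrite /g vec_mx_eq0.
by have := vmax (mxvec x); rewrite /g mxvecK.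
Qed.

(** * The Perron vector of the mixing matrix *)

Section Network.
Variables (R : realType) (n : nat) (E : rel 'I_n.+1).
Variables (W : 'M[R]_n.+1) (pi : 'cV[R]_n.+1).
Hypotheses (hE : strongly_connected E) (hW : mixing_matrix E W).
Hypothesis hpi : stationary W pi.

Lemma mixing_ge0 i j : 0 <= W i j.
Proof.
case: hW => W0 W1 _; case: (boolP (E i j || (i == j))) => [/W0/ltW//|/W1->//].
Qed.

Lemma stationaryE i : \sum_j W i j * pi j 0 = pi i 0.
Proof. by case: hpi => /matrixP/(_ i 0); rewrite mxE. Qed.

(** Passing to absolute values in the eigenvector equation can only increase
    its right-hand side, and column stochasticity forces equality; so the
    nonnegative vector |pi| + pi is stationary too, and its support, which is
    closed under predecessors in E, is everything. *)
Lemma stationary_gt0 i : 0 < pi i 0.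
Proof.
case: (hW) => W0 _ W1.
have absE k : \sum_j W k j * `|pi j 0| = `|pi k 0|.
  apply/eqP; rewrite -subr_eq0; apply/eqP; move: k (erefl true).
  have g0 k : true -> 0 <= \sum_j W k j * `|pi j 0| - `|pi k 0|.
    move=> _; rewrite subr_ge0 -stationaryE (le_trans (ler_norm_sum _ _ _))//.
    by apply: ler_sum => j _; rewrite normrM ger0_norm// mixing_ge0.
  apply: psumr_eq0P g0 _; rewrite sumrB exchange_big/= -sumrB big1// => j _.
  by rewrite -mulr_suml W1 mul1r subrr.
pose q k := `|pi k 0| + pi k 0.
have qE k : q k = \sum_j W k j * q j.
  rewrite /q -{1}absE -{1}stationaryE -big_split/=.
  by apply: eq_bigr => j _; rewrite mulrDr.
have q0 k : 0 <= q k by rewrite /q -lerBlDr sub0r -normrN ler_norm.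
have qpred k j : E k j -> 0 < q j -> 0 < q k.
  move=> Ekj qj; rewrite qE (bigD1 j)//=; apply: ltr_wpDr.
    by apply: sumr_ge0 => l _; rewrite mulr_ge0// mixing_ge0.
  by rewrite mulr_gt0// W0// Ekj.
have [j qj] : exists j, 0 < q j.
  apply/existsP; apply: contraT; rewrite negb_exists => /forallP qle0.
  have : \sum_j pi j 0 <= \sum_j q j.
    by apply: ler_sum => j _; rewrite /q lerDr.
  have -> : \sum_j q j = 0.
    by apply: big1 => j _; apply/eqP; rewrite eq_le q0 andbT leNgt.
  by case: hpi => _ ->; rewrite ler10.
have : 0 < q i.
  have /connectP[p + jE] := hE i j; rewrite {}jE in qj.
  elim: p i qj => [//|l p IH] k qj /= /andP[kl lp].
  exact: qpred kl (IH _ qj lp).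
rewrite /q; case: (ltP 0 (pi i 0)) => // pi0.
by rewrite ler0_norm// addNr ltxx.
Qed.

Lemma stationary_le1 i : pi i 0 <= 1.
Proof.
case: hpi => _ <-; rewrite (bigD1 i)//= lerDl.
by apply: sumr_ge0 => j _; exact/ltW/stationary_gt0.
Qed.

End Network.

(** * Euclidean and weighted norms *)

Section EuclideanNorm.
Variables (R : realType) (d : nat).
Implicit Types x y : 'cV[R]_d.+1.

Definition dotp x y : R := \sum_i x i 0 * y i 0.

Lemma psd_dotp : psd_form dotp.
Proof.
split=> [x y|a x y z|x].
- by apply: eq_bigr => i _; rewrite mulrC.
- rewrite /dotp mulr_sumr -big_split/=; apply: eq_bigr => i _.
  by rewrite !mxE mulrDl mulrA.
- by apply: sumr_ge0 => i _; rewrite -expr2 sqr_ge0.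
Qed.

Lemma dotp_ge0 x : 0 <= dotp x x.
Proof. exact: psd_ge0 psd_dotp x. Qed.

Lemma dotp_gt0 x : x != 0 -> 0 < dotp x x.
Proof.
move=> x0; rewrite lt_neqAle dotp_ge0 andbT eq_sym; apply: contra x0.
move=> /eqP dx0; apply/eqP/colP => i; rewrite mxE.
have /psumr_eq0P : forall j, true -> 0 <= x j 0 * x j 0.
  by move=> j _; rewrite -expr2 sqr_ge0.
move=> /(_ dx0 i isT)/eqP.
by rewrite -expr2 sqrf_eq0 => /eqP.
Qed.

Lemma dotp_ones_gt0 : 0 < dotp (const_mx 1) (const_mx 1).
Proof.
apply: dotp_gt0; apply/eqP => /colP/(_ 0); rewrite !mxE.
exact/eqP/oner_neq0.
Qed.

Lemma enormE x : enorm x = Num.sqrt (dotp x x).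
Proof. by []. Qed.

Lemma sqr_enorm x : enorm x ^+ 2 = dotp x x.
Proof. by rewrite enormE sqr_sqrtr// dotp_ge0. Qed.

Lemma enorm_ge0 x : 0 <= enorm x.
Proof. exact: sqrtr_ge0. Qed.

Lemma enormZ a x : enorm (a *: x) = `|a| * enorm x.
Proof. by rewrite !enormE (psd_sq psd_dotp) sqrtrM ?sqr_ge0// sqrtr_sqr. Qed.

Lemma dotp_le_enorm x y : dotp x y <= enorm x * enorm y.
Proof. exact: psd_le_norms psd_dotp x y. Qed.

Lemma enorm_le_sqr (c : R) x y : 0 <= c ->
  dotp x x <= c ^+ 2 * dotp y y -> enorm x <= c * enorm y.
Proof.
move=> c0 h; rewrite -(ger0_norm c0) -enormZ !enormE (psd_sq psd_dotp).
exact: ler_wsqrtr.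
Qed.

End EuclideanNorm.

Section WeightedNorm.
Variables (R : realType) (n d : nat) (pi : 'cV[R]_n.+1).
Hypotheses (pi_gt0 : forall j, 0 < pi j 0) (pi_le1 : forall j, pi j 0 <= 1).
Implicit Types w z : 'M[R]_(d.+1, n.+1).

(** The inner product whose norm is the weighted norm of stacked vectors. *)
Definition wdot w z : R := \sum_j (pi j 0)^-1 * dotp (col j w) (col j z).

Lemma psd_wdot : psd_form wdot.
Proof.
apply: psd_form_sum => j; first by rewrite invr_ge0 ltW.
by apply: psd_form_comp (@psd_dotp R d) => a x y; rewrite linearP.
Qed.

Lemma wnormE w : wnorm pi w = Num.sqrt (wdot w w).
Proof.
by congr Num.sqrt; apply: eq_bigr => j _; rewrite sqr_enorm.
Qed.

Lemma wnorm_ge0 w : 0 <= wnorm pi w.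
Proof. exact: sqrtr_ge0. Qed.

Lemma sqr_wnorm w : wnorm pi w ^+ 2 = wdot w w.
Proof. by rewrite wnormE sqr_sqrtr// (psd_ge0 psd_wdot). Qed.

Lemma wnormD w z : wnorm pi (w + z) <= wnorm pi w + wnorm pi z.
Proof. by rewrite !wnormE; exact: psd_triangle psd_wdot w z. Qed.

Lemma wnormZ a w : wnorm pi (a *: w) = `|a| * wnorm pi w.
Proof. by rewrite !wnormE (psd_sq psd_wdot) sqrtrM ?sqr_ge0// sqrtr_sqr. Qed.

(** The norm on the left is the sup norm; the weights 1 / pi_j are at least 1. *)
Lemma norm_le_wnorm w : `|w| <= wnorm pi w.
Proof.
rewrite /Num.norm/= mx_normrE; apply/bigmax_leP; split; first exact: wnorm_ge0.
move=> [i j] _ /=; rewrite wnormE -sqrtr_sqr; apply: ler_wsqrtr.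
have dj : w i j ^+ 2 <= dotp (col j w) (col j w).
  rewrite /dotp (bigD1 i)//= !mxE -expr2 lerDl.
  by apply: sumr_ge0 => k _; rewrite -expr2 sqr_ge0.
rewrite (le_trans dj)// /wdot (bigD1 j)//= -[leLHS]addr0; apply: lerD.
  by rewrite ler_peMl ?dotp_ge0// invf_ge1.
by apply: sumr_ge0 => k _; rewrite mulr_ge0 ?invr_ge0 ?dotp_ge0// ltW.
Qed.

Lemma wnorm_gt0 w : w != 0 -> 0 < wnorm pi w.
Proof. by rewrite -normr_gt0 => /lt_le_trans; apply; exact: norm_le_wnorm. Qed.

Lemma wdot_gt0 w : w != 0 -> 0 < wdot w w.
Proof. by move=> w0; rewrite -sqr_wnorm exprn_gt0// wnorm_gt0. Qed.

Lemma coord_le_norm w i j : `|w i j| <= `|w|.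
Proof.
by rewrite [leRHS]/Num.norm/= mx_normrE; apply: (le_bigmax _ _ (i, j)).
Qed.

Lemma wnorm_le_norm :
  exists2 K : R, 0 <= K & forall w, wnorm pi w <= K * `|w|.
Proof.
exists (Num.sqrt (\sum_j (pi j 0)^-1 * d.+1%:R)) => [|w]; first exact: sqrtr_ge0.
rewrite wnormE -[X in _ * X]ger0_norm// -sqrtr_sqr mulrC -sqrtrM ?sqr_ge0//.
apply: ler_wsqrtr; rewrite mulr_sumr; apply: ler_sum => j _.
rewrite mulrCA ler_pM2l ?invr_gt0// mulr_natr.
have -> : `|w| ^+ 2 *+ d.+1 = \sum_(i < d.+1) `|w| ^+ 2.
  by rewrite sumr_const card_ord.
apply: ler_sum => i _; rewrite !mxE -expr2 -[leLHS]ger0_norm ?sqr_ge0//.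
by rewrite normrX lerXn2r ?nnegrE// coord_le_norm.
Qed.

(* Matrices are complete and normed; this declares the join of the two. *)
HB.instance Definition _ :=
  Complete.copy 'M[R]_(d.+1, n.+1) 'M[R]_(d.+1, n.+1).

(** Banach's theorem for the weighted norm. A high enough iterate of T is a
    contraction for the sup norm, which is equivalent to the weighted one; its
    fixed point is fixed by T as well, by uniqueness. *)
Lemma wnorm_contraction_fixpoint (T : 'M[R]_(d.+1, n.+1) -> 'M[R]_(d.+1, n.+1))
    (q : R) : 0 <= q < 1 ->
  (forall x y, wnorm pi (T x - T y) <= q * wnorm pi (x - y)) ->
  exists! w, T w = w.
Proof.
move=> /andP[q0 q1] hT.
have uniqT x y : T x = x -> T y = y -> x = y.
  move=> hx hy; apply/eqP; rewrite -subr_eq0; apply: contraT => /wnorm_gt0 xy0.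
  by have := hT x y; rewrite hx hy ler_pMl// leNgt q1.
have iterT N x y :
    wnorm pi (iter N T x - iter N T y) <= q ^+ N * wnorm pi (x - y).
  elim: N => [|N IH]; first by rewrite mul1r.
  rewrite !iterS (le_trans (hT _ _))// exprS -mulrA.
  exact: ler_wpM2l.
have [K K0 hK] := wnorm_le_norm.
have [N hN] : exists N, q ^+ N * K < 1.
  have /cvgrPdist_lt/(_ (K + 1)^-1) : (GRing.exp q @ \oo --> (0 : R))%classic.
    by apply: cvg_expr; rewrite ger0_norm.
  rewrite invr_gt0 ltr_wpDl// => /(_ isT)[N _ /(_ N (leqnn N))]/=.
  rewrite sub0r normrN ger0_norm ?exprn_ge0// => hN; exists N.
  have K1 : 0 < K + 1 by rewrite ltr_wpDl.
  have : q ^+ N * (K + 1) < 1 by rewrite -ltr_pdivlMr// div1r.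
  by apply: le_lt_trans; rewrite ler_wpM2l ?exprn_ge0// lerDl.
have qK0 : 0 <= q ^+ N * K by rewrite mulr_ge0 ?exprn_ge0.
(* the total space is the closed set on which the iterate is a contraction *)
pose S : {fun [set: 'M[R]_(d.+1, n.+1)]%classic >-> _} :=
  [fun of totalfun (iter N T)].
have [|||p _ pE] := @banach_fixed_point R 'M[R]_(d.+1, n.+1) setT S.
- exists (NngNum qK0); split => //= -[x y] _ /=.
  rewrite (le_trans (norm_le_wnorm _))// (le_trans (iterT _ _ _))//.
  by rewrite -mulrA ler_wpM2l// exprn_ge0.
- exact: closedT.
- by exists 0.
have uniqI y z : iter N T y = y -> iter N T z = z -> y = z.
  move=> hy hz; apply/eqP; rewrite -subr_eq0; apply: contraT.
  rewrite -normr_gt0 => yz0; have := norm_le_wnorm (iter N T y - iter N T z).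
  move=> /le_trans/(_ (iterT _ _ _)).
  move=> /le_trans/(_ (ler_wpM2l (exprn_ge0 N q0) (hK _))).
  by rewrite mulrA hy hz ler_pMl// leNgt hN.
exists p; split=> [|y hy].
  have {}pE : iter N T p = p by exact: esym pE.
  by apply: uniqI => //; rewrite -iterSr iterS pE.
have iy : iter N T y = y by elim: (N) => //= k ->.
by apply: uniqI => //; exact: esym pE.
Qed.

End WeightedNorm.

(** * Mixing, local gradient steps and contractive families *)

(** The gradient steps of the agents, before mixing. *)
Definition local_step (R : realType) n d (pi : 'cV[R]_n.+1)
    (f : 'I_n.+1 -> 'cV[R]_d.+1 -> R) (alpha : R) (w : 'M[R]_(d.+1, n.+1)) :
    'M[R]_(d.+1, n.+1) :=
  \matrix_(i, j) (col j w -
    alpha *: grad (f j) ((n.+1%:R * pi j 0)^-1 *: col j w)) i 0.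

Section Mixing.
Variables (R : realType) (n d : nat) (E : rel 'I_n.+1).
Variables (W : 'M[R]_n.+1) (pi : 'cV[R]_n.+1).
Hypotheses (hE : strongly_connected E) (hW : mixing_matrix E W).
Hypothesis hpi : stationary W pi.
Implicit Types (w z : 'M[R]_(d.+1, n.+1)) (f : 'I_n.+1 -> 'cV[R]_d.+1 -> R).

Let pi_gt0 := stationary_gt0 hE hW hpi.
Let pi_le1 := stationary_le1 hE hW hpi.

Lemma mixE w i k : mix W w i k = \sum_j W k j * w i j.
Proof. by rewrite mxE summxE; apply: eq_bigr => j _; rewrite !mxE. Qed.

Lemma mix_linear a w z : mix W (a *: w + z) = a *: mix W w + mix W z.
Proof.
apply/matrixP => i k; rewrite [in RHS]mxE [in RHS]mxE !mixE mulr_sumr -big_split/=.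
by apply: eq_bigr => j _; rewrite !mxE mulrDr mulrCA.
Qed.

Lemma mixB w z : mix W (w - z) = mix W w - mix W z.
Proof. by rewrite addrC -scaleN1r mix_linear scaleN1r addrC. Qed.

Lemma mix0 : mix W (0 : 'M[R]_(d.+1, n.+1)) = 0.
Proof. by have := mixB 0 0; rewrite !subrr. Qed.

Lemma mixZ a w : mix W (a *: w) = a *: mix W w.
Proof. by rewrite -[a *: w]addr0 mix_linear mix0 addr0. Qed.

(** Jensen's inequality for the square, with its defect: averaging with the
    weights W k j * pi j / pi k loses exactly the variance. *)
Lemma mix_defect w : wdot pi w w - wdot pi (mix W w) (mix W w) =
  \sum_k \sum_i \sum_j W k j * pi j 0 *
    (w i j / pi j 0 - mix W w i k / pi k 0) ^+ 2.
Proof.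
have wdotE (z : 'M[R]_(d.+1, n.+1)) :
    wdot pi z z = \sum_j \sum_i (pi j 0)^-1 * z i j ^+ 2.
  rewrite /wdot; apply: eq_bigr => j _; rewrite mulr_sumr.
  by apply: eq_bigr => i _; rewrite !mxE expr2.
have varE k i : \sum_j W k j * pi j 0 *
    (w i j / pi j 0 - mix W w i k / pi k 0) ^+ 2 =
  \sum_j W k j * ((pi j 0)^-1 * w i j ^+ 2) -
    (pi k 0)^-1 * mix W w i k ^+ 2.
  set m := mix W w i k.
  have -> : \sum_j W k j * pi j 0 * (w i j / pi j 0 - m / pi k 0) ^+ 2 =
      \sum_j W k j * ((pi j 0)^-1 * w i j ^+ 2)
      - 2 * (m / pi k 0) * (\sum_j W k j * w i j)
      + (m / pi k 0) ^+ 2 * (\sum_j W k j * pi j 0).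
    rewrite !mulr_sumr -sumrB -big_split/=; apply: eq_bigr => j _.
    by field; rewrite !gt_eqF.
  by rewrite (stationaryE hpi) -mixE -/m; field; rewrite gt_eqF.
under [RHS]eq_bigr => k _.
  under eq_bigr => i _ do rewrite varE.
  rewrite sumrB; over.
rewrite sumrB -wdotE; congr (_ - _); rewrite wdotE.
rewrite exchange_big/= [RHS]exchange_big/=; apply: eq_bigr => i _.
rewrite exchange_big/=; apply: eq_bigr => j _.
by case: hW => _ _ W1; rewrite -mulr_suml W1 mul1r.
Qed.

Lemma mix_defect_ge0 w k i j : 0 <= W k j * pi j 0 *
    (w i j / pi j 0 - mix W w i k / pi k 0) ^+ 2.
Proof.
by rewrite mulr_ge0 ?sqr_ge0// mulr_ge0 ?(mixing_ge0 hW)// ltW.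
Qed.

Lemma wdot_mix_le w : wdot pi (mix W w) (mix W w) <= wdot pi w w.
Proof.
rewrite -subr_ge0 mix_defect; do 3!apply: sumr_ge0 => ? _.
exact: mix_defect_ge0.
Qed.

Lemma wnorm_mix_le w : wnorm pi (mix W w) <= wnorm pi w.
Proof. by rewrite !wnormE; apply: ler_wsqrtr; exact: wdot_mix_le. Qed.

(** Mixing preserves the weighted norm of w only if all the w_j / pi_j are
    equal. A zero defect makes w_j / pi_j equal to (J w)_k / pi_k whenever
    W k j > 0: for the successors j of k, and for j = k. *)
Lemma mix_isometric_consensus w :
  wdot pi (mix W w) (mix W w) = wdot pi w w ->
  forall i j k, w i j / pi j 0 = w i k / pi k 0.
Proof.
move=> iso.
have edge i j k : E k j || (k == j) ->
    w i j / pi j 0 = mix W w i k / pi k 0.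
  move=> Ekj; have := mix_defect w; rewrite iso subrr => /esym def0.
  have ge0 := mix_defect_ge0 w.
  have /(_ k isT) def1 := psumr_eq0P (fun k _ => sumr_ge0 _ (fun i _ =>
    sumr_ge0 _ (fun j _ => ge0 k i j))) def0.
  have /(_ i isT) def2 :=
    psumr_eq0P (fun i _ => sumr_ge0 _ (fun j _ => ge0 k i j)) def1.
  have /(_ j isT)/eqP := psumr_eq0P (fun j _ => ge0 k i j) def2.
  rewrite mulf_eq0 sqrf_eq0 subr_eq0 => /predU1P[|/eqP//].
  case: hW => Wpos _ _.
  by move/eqP; rewrite gt_eqF// mulr_gt0// Wpos.
move=> i j k; have /connectP[p + ->] := hE j k.
elim: p j => [//|l p IH] j /= /andP[jl lp]; rewrite -(IH l lp).
by rewrite (edge i j j) ?eqxx ?orbT// (edge i l j)// jl.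
Qed.

Lemma TstepE f alpha w : Tstep W pi f alpha w = mix W (local_step pi f alpha w).
Proof.
apply/matrixP => i k; rewrite !mxE !summxE; apply: eq_bigr => j _.
by rewrite !mxE.
Qed.

Lemma Tstep0 f alpha : Tstep W pi f alpha 0 = - alpha *: mix W (gradF f 0).
Proof.
rewrite TstepE -mixZ; congr mix; apply/matrixP => i j.
by rewrite !mxE col0 scaler0 sub0r mulNr.
Qed.

(** The mixing being nonexpansive, the gradient steps may be estimated one
    agent at a time. *)
Lemma Tstep_lipschitz f alpha (q : R) : 0 <= q ->
  (forall j w z, enorm (col j (local_step pi f alpha w - local_step pi f alpha z))
     <= q * enorm (col j (w - z))) ->
  forall w z, wnorm pi (Tstep W pi f alpha w - Tstep W pi f alpha z) <=
     q * wnorm pi (w - z).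
Proof.
move=> q0 hq w z; rewrite !TstepE -mixB (le_trans (wnorm_mix_le _))//.
rewrite -[in leRHS](ger0_norm q0) -(wnormZ pi_gt0); apply: ler_wsqrtr.
apply: ler_sum => j _; rewrite ler_pM2l ?invr_gt0//.
rewrite linearZ/= enormZ ger0_norm//.
by rewrite lerXn2r ?nnegrE ?mulr_ge0// ?enorm_ge0//.
Qed.

(** Fixed points exist, are unique and bounded as soon as T_alpha contracts at
    a rate affine in alpha. *)
Lemma contractive_family f (alpha0 C : R) : 0 < C ->
  (forall alpha, 0 < alpha <= alpha0 -> alpha * C <= 1 /\
     forall w z, wnorm pi (Tstep W pi f alpha w - Tstep W pi f alpha z) <=
       (1 - alpha * C) * wnorm pi (w - z)) ->
  unique_fixed_points (Tstep W pi f) alpha0 /\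
  fixed_points_bounded pi (Tstep W pi f) alpha0
    (C^-1 * wnorm pi (mix W (gradF f 0))).
Proof.
move=> C0 hT; split=> [a /[dup] a0 /hT[aC hTa]|v hv].
  apply: (wnorm_contraction_fixpoint pi_gt0 pi_le1 _ hTa).
  by rewrite subr_ge0 aC ltrBlDr ltrDl mulr_gt0//; case/andP: a0.
apply: ge_ereal_sup => _ [a /= a0 <-]; rewrite lee_fin.
have [_ hTa] := hT _ a0; have va := hv _ a0; case/andP: a0 => a0 _.
rewrite mulrC ler_pdivlMr//.
have : wnorm pi (v a) <= (1 - a * C) * wnorm pi (v a) +
    a * wnorm pi (mix W (gradF f 0)).
  rewrite -[in leLHS]va -[in leLHS](subrK (Tstep W pi f a 0) (Tstep W pi f a _)).
  rewrite (le_trans (wnormD pi_gt0 _ _))// lerD//.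
    by have := hTa (v a) 0; rewrite subr0.
  by rewrite Tstep0 (wnormZ pi_gt0) normrN gtr0_norm.
rewrite mulrBl mul1r -lerBlDl opprB addrCA subrr addr0 -mulrA ler_pM2l//.
by rewrite mulrC.
Qed.

End Mixing.

(** * Smooth and strongly convex functions *)

Lemma le0_of_small (R : realFieldType) (x k : R) :
  (forall t, 0 < t <= 1 -> x <= t * k) -> x <= 0.
Proof.
move=> h; rewrite leNgt; apply/negP => x0.
have xk : 0 < x + `|k| by rewrite ltr_wpDr.
have := h (x / (x + `|k|)).
rewrite divr_gt0// ler_pdivrMr// mul1r lerDl normr_ge0 => /(_ isT).
rewrite mulrAC ler_pdivlMr// ler_pM2l// => h1.
have := le_lt_trans (ler_norm k) (_ : `|k| < x + `|k|).
by rewrite ltrDr => /(_ x0); rewrite ltNge h1.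
Qed.

Section SmoothConvex.
Variables (R : realType) (d : nat).
Implicit Types (f : 'cV[R]_d.+1 -> R) (x y v : 'cV[R]_d.+1).

Lemma derive_grad f x v : differentiable f x -> 'D_v f x = dotp (grad f x) v.
Proof.
move=> df; rewrite deriveE// {1}[v]matrix_sum_delta linear_sum.
apply: eq_bigr => i _; rewrite big_ord1 linearZ/= mxE deriveE//.
by rewrite mulrC.
Qed.

Lemma is_derive_line f x v (t : R) : differentiable f (x + t *: v) ->
  is_derive t 1 (fun s : R => f (x + s *: v)) (dotp (grad f (x + t *: v)) v).
Proof.
move=> df; rewrite -derive_grad//.
have E : (fun h : R => h^-1 *: (((fun s : R => f (x + s *: v)) \o shift t) (h *: 1)
     - f (x + t *: v))) =
   (fun h : R => h^-1 *: ((f \o shift (x + t *: v)) (h *: v) - f (x + t *: v))).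
  apply/funext => h /=; congr (_ *: (f _ - _)).
  by rewrite scalerDl addrCA [h *: 1]mulr1.
split; first by rewrite /derivable E; exact: diff_derivable.
by rewrite /derive E.
Qed.

(** The descent lemma, in both directions: the mean value theorem is applied
    to t |-> s (f (x + t v) - t <grad f x, v>) - t^2 (L / 2) |v|^2, with
    s = 1 and s = -1. *)
Lemma smooth_descent (L : R) f x v : smooth L f ->
  `|f (x + v) - f x - dotp (grad f x) v| <= L / 2 * dotp v v.
Proof.
move=> [df Lf]; pose hd := @psd_dotp R d.
have main (s : R) : `|s| = 1 ->
    s * (f (x + v) - f x - dotp (grad f x) v) <= L / 2 * dotp v v.
  move=> s1; pose a := dotp (grad f x) v; pose b := L / 2 * dotp v v.
  pose h (t : R) := f (x + t *: v).
  pose g (t : R) := s * (h t - a * t) - b * t ^+ 2.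
  pose dg t := s * (dotp (grad f (x + t *: v)) v - a) - b * (2 * t).
  have gD (t : R) : is_derive t 1 g (dg t).
    have hD : is_derive t 1 h (dotp (grad f (x + t *: v)) v).
      exact: is_derive_line.
    rewrite /g /dg; apply: is_derive_eq.
    by rewrite /GRing.scale/=; ring.
  have [|c /andP[c0 c1]] := @MVT R g dg 0 1 ltr01 (fun t _ => gD t).
    by apply: derivable_within_continuous => t _.
  rewrite subr0 mulr1 /g /h scale1r scale0r addr0 !mulr1 !mulr0 subr0.
  rewrite -/a => gE.
  pose e := grad f (x + c *: v) - grad f x.
  have eE : dotp (grad f (x + c *: v)) v - a = dotp e v.
    by rewrite /e (psdDl hd) (psdNl hd).
  have se : s * dotp e v <= enorm e * enorm v.
    rewrite -(psdZl hd) (le_trans (dotp_le_enorm _ _))//.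
    by rewrite enormZ s1 mul1r.
  have eL : enorm e <= L * (c * enorm v).
    have := Lf (x + c *: v) x; rewrite [x + _]addrC addrK enormZ gtr0_norm//.
    by rewrite [_ + x]addrC.
  have := ler_wpM2r (enorm_ge0 v) eL.
  rewrite -!mulrA -expr2 sqr_enorm => eL2.
  have : dg c <= 0 by rewrite /dg eE /b; lra.
  by rewrite -gE /b; lra.
rewrite ler_norml; apply/andP; split.
  by have := main (-1); rewrite normrN normr1 mulN1r lerNl => /(_ erefl).
by have := main 1; rewrite normr1 mul1r => /(_ erefl).
Qed.

(** The definition of strong convexity between x and x + v, at the parameter t,
    is compared with the lower quadratic bound of the descent lemma at
    x + t v; then t tends to 0. *)
Lemma strongly_convex_first_order (mu L : R) f x v :
  strongly_convex mu f -> smooth L f ->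
  f x + dotp (grad f x) v + mu / 2 * dotp v v <= f (x + v).
Proof.
move=> cf sf; rewrite -subr_le0.
apply: (@le0_of_small _ _ ((L + mu) / 2 * dotp v v)) => t /andP[t0 t1].
have := cf (x + v) x t; rewrite (ltW t0) t1 => /(_ isT).
have -> : t *: (x + v) + (1 - t) *: x = x + t *: v.
  by rewrite scalerDr scalerBl scale1r addrC addrA subrK.
rewrite [x + v]addrC addrK sqr_enorm [v + x]addrC => conv.
have := smooth_descent x (t *: v) sf.
rewrite (psd_sq (@psd_dotp R d)) (psdZr (@psd_dotp R d)) ler_norml => /andP[low _].
rewrite -(ler_pM2l t0); nra.
Qed.

Lemma strongly_convex_smooth_le (mu L : R) f :
  strongly_convex mu f -> smooth L f -> mu <= L.
Proof.
move=> cf sf; pose v : 'cV[R]_d.+1 := const_mx 1.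
have v0 : 0 < dotp v v := dotp_ones_gt0 R d.
have := strongly_convex_first_order 0 v cf sf.
have := smooth_descent 0 v sf; rewrite ler_norml => /andP[_ up] low.
have : mu / 2 * dotp v v <= L / 2 * dotp v v by lra.
by rewrite ler_pM2r// ler_pM2r// invr_gt0.
Qed.

(** A convex function lying between its tangent planes and the paraboloids of
    curvature M over them has a (1/M)-cocoercive gradient: evaluate both
    bounds at the minimizer of the upper paraboloid at y. *)
Lemma cocoercive_of_quadratic_bounds (M : R) (phi : 'cV[R]_d.+1 -> R)
    (p : 'cV[R]_d.+1 -> 'cV[R]_d.+1) : 0 < M ->
  (forall x v, phi x + dotp (p x) v <= phi (x + v)) ->
  (forall x v, phi (x + v) <= phi x + dotp (p x) v + M / 2 * dotp v v) ->
  forall x y, dotp (p y - p x) (p y - p x) <= M * dotp (p y - p x) (y - x).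
Proof.
move=> M0 lo up.
pose hd := @psd_dotp R d.
have half x y : phi x + dotp (p x) (y - x) +
    (2 * M)^-1 * dotp (p y - p x) (p y - p x) <= phi y.
  pose e := p y - p x; pose u := - M^-1 *: e.
  have := lo x (y - x + u); have := up y u.
  have -> : x + (y - x + u) = y + u by rewrite addrA [x + _]addrC subrK.
  rewrite (psdDr hd) => uu ll.
  have uE : dotp u u = M^-1 ^+ 2 * dotp e e by rewrite /u (psd_sq hd) sqrrN.
  have puE : dotp (p y) u - dotp (p x) u = - M^-1 * dotp e e.
    by rewrite -(psdNl hd) -(psdDl hd) -/e /u (psdZr hd).
  have MuE : M / 2 * dotp u u = (2 * M)^-1 * dotp e e.
    by rewrite uE; field; rewrite gt_eqF.
  have MeE : M^-1 * dotp e e = 2 * ((2 * M)^-1 * dotp e e).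
    by field; rewrite gt_eqF.
  by move: uu ll puE; rewrite MuE mulNr MeE -/e; lra.
move=> x y; have := half x y; have := half y x.
set e := p y - p x; set w := y - x.
have -> : p x - p y = - e by rewrite opprB.
have -> : x - y = - w by rewrite opprB.
rewrite (psdNl hd) !(psdNr hd) opprK => h1 h2.
have eE : dotp e w = dotp (p y) w - dotp (p x) w.
  by rewrite (psdDl hd) (psdNl hd).
rewrite -ler_pdivrMl//.
have -> : M^-1 * dotp e e = 2 * ((2 * M)^-1 * dotp e e).
  by field; rewrite gt_eqF.
by lra.
Qed.

(** The gradient inequality for strongly convex smooth functions: the lemma
    above applied to f minus its strong convexity paraboloid. Enlarging L a
    little avoids the degenerate curvature L - mu = 0. *)
Lemma strongly_convex_smooth_cocoercive (mu L : R) f :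
  strongly_convex mu f -> smooth L f ->
  forall x y, mu * L * dotp (y - x) (y - x) +
      dotp (grad f y - grad f x) (grad f y - grad f x) <=
    (L + mu) * dotp (grad f y - grad f x) (y - x).
Proof.
move=> cf sf x y; pose hd := @psd_dotp R d.
set w := y - x; set e := grad f y - grad f x.
have muL := strongly_convex_smooth_le cf sf.
rewrite -subr_le0.
apply: (@le0_of_small _ _ (dotp e w - mu * dotp w w)) => t /andP[t0 _].
pose phi z := f z - mu / 2 * dotp z z; pose p z := grad f z - mu *: z.
have pv z v : dotp (p z) v = dotp (grad f z) v - mu * dotp z v.
  by rewrite (psdDl hd) (psdNl hd) (psdZl hd).
have M0 : 0 < L + t - mu by rewrite addrAC ltr_wpDl// subr_ge0.
have [] : (forall z v, phi z + dotp (p z) v <= phi (z + v)) /\ (forall z v,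
    phi (z + v) <= phi z + dotp (p z) v + (L + t - mu) / 2 * dotp v v).
  split=> z v; rewrite /phi pv (psdDsq hd).
    by have := strongly_convex_first_order z v cf sf; lra.
  have := smooth_descent z v sf; rewrite ler_norml => /andP[_].
  by have := mulr_ge0 (ltW t0) (dotp_ge0 v); nra.
move=> lo up; have := cocoercive_of_quadratic_bounds M0 lo up x y.
have -> : p y - p x = e - mu *: w.
  by rewrite /p /e /w; apply/colP => i; rewrite !mxE; ring.
rewrite (psdBsq hd) (psd_sq hd) (psdZr hd) -/w.
rewrite (psdDl hd e) (psdNl hd) (psdZl hd); lra.
Qed.

End SmoothConvex.

(** One gradient step, with the gradient taken at the rescaled point x / kappa.
    By cocoercivity the squared norm is multiplied by at most
    1 - 2 alpha c, which is at most (1 - alpha c)^2. *)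
Lemma gradient_step_contraction (R : realType) d (f : 'cV[R]_d.+1 -> R)
    (mu L kappa alpha : R) : 0 < mu -> 0 < kappa ->
  strongly_convex mu f -> smooth L f ->
  0 < alpha <= 2 * kappa / (L + mu) ->
  let c := mu * L / (kappa * (mu + L)) in
  [/\ 0 < c, alpha * c <= 1 & forall x y,
    enorm (x - y - alpha *: (grad f (kappa^-1 *: x) - grad f (kappa^-1 *: y)))
      <= (1 - alpha * c) * enorm (x - y)].
Proof.
move=> mu0 k0 cf sf /andP[a0 aD] c; pose hd := @psd_dotp R d.
have muL := strongly_convex_smooth_le cf sf.
have L0 : 0 < L := lt_le_trans mu0 muL.
have D0 : 0 < L + mu by rewrite addr_gt0.
have c0 : 0 < c by rewrite divr_gt0 ?mulr_gt0// addr_gt0.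
have ac1 : alpha * c <= 1.
  apply: (@le_trans _ _ (2 * kappa / (L + mu) * c)); first by rewrite ler_pM2r.
  have -> : 2 * kappa / (L + mu) * c = 2 * mu * L / (L + mu) ^+ 2.
    by rewrite /c; field; rewrite !gt_eqF// addrC.
  (* 2 mu L is at most (L + mu)^2 *)
  rewrite ler_pdivrMr ?exprn_gt0// mul1r sqrrD.
  by have := sqr_ge0 L; have := sqr_ge0 mu; nra.
split=> // x y; apply: enorm_le_sqr; first by rewrite subr_ge0.
set w := x - y; set e := grad f _ - grad f _.
have := strongly_convex_smooth_cocoercive cf sf (kappa^-1 *: y) (kappa^-1 *: x).
rewrite -/e -scalerBr -/w (psd_sq hd) (psdZr hd) => coc.
rewrite (psdBsq hd) (psd_sq hd) (psdZr hd) (psd_sym hd w e).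
set N := dotp w w in coc *; set G := dotp e e in coc *.
set s := dotp e w in coc *.
have N0 : 0 <= N by exact: dotp_ge0.
have G0 : 0 <= G by exact: dotp_ge0.
have sE : c * N + kappa / (L + mu) * G <= s.
  have -> : s = kappa / (L + mu) * ((L + mu) * (kappa^-1 * s)).
    by field; rewrite !gt_eqF.
  have -> : c * N + kappa / (L + mu) * G =
      kappa / (L + mu) * (mu * L * (kappa^-1 ^+ 2 * N) + G).
    by rewrite /c; field; rewrite !gt_eqF// addrC.
  by rewrite ler_pM2l// divr_gt0.
have aG : alpha * G <= 2 * (kappa / (L + mu)) * G.
  by rewrite ler_wpM2r// mulrA.
have := ler_wpM2l (ltW a0) sE; have := ler_wpM2l (ltW a0) aG.
by have := mulr_ge0 (sqr_ge0 (alpha * c)) N0; nra.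
Qed.

Lemma min_ord_le (R : realType) n (g : 'I_n.+1 -> R) k : min_ord g <= g k.
Proof. exact: bigmin_le. Qed.

Lemma min_ord_gt0 (R : realType) n (g : 'I_n.+1 -> R) :
  (forall k, 0 < g k) -> 0 < min_ord g.
Proof. by move=> g0; apply: lt_bigmin => // k _. Qed.

Lemma local_stepB (R : realType) n d (pi : 'cV[R]_n.+1)
    (f : 'I_n.+1 -> 'cV[R]_d.+1 -> R) alpha (w z : 'M[R]_(d.+1, n.+1)) j :
  col j (local_step pi f alpha w - local_step pi f alpha z) =
  col j w - col j z - alpha *:
    (grad (f j) ((n.+1%:R * pi j 0)^-1 *: col j w) -
     grad (f j) ((n.+1%:R * pi j 0)^-1 *: col j z)).
Proof. by apply/colP => i; rewrite !mxE; ring. Qed.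

(** * Positive semidefinite matrices and convex quadratics *)

Section Quadratic.
Variables (R : realType) (d : nat).
Implicit Types (A : 'M[R]_d.+1) (B : 'rV[R]_d.+1) (x y v : 'cV[R]_d.+1).

Let hd := @psd_dotp R d.

Lemma dotpE x y : dotp x y = (x^T *m y) 0 0.
Proof. by rewrite mxE; apply: eq_bigr => i _; rewrite mxE. Qed.

Lemma dotp_mulmx A x y : A^T = A -> dotp (A *m x) y = (x^T *m A *m y) 0 0.
Proof. by move=> sA; rewrite dotpE trmx_mul sA. Qed.

Lemma psd_mulmx A : A^T = A -> possemidef A ->
  psd_form (fun x y => dotp (A *m x) y).
Proof.
move=> sA pA; split=> [x y|a x y z|x].
- by rewrite (psd_sym hd) dotpE dotp_mulmx// mulmxA.
- by rewrite mulmxDr -scalemxAr (psd_linear hd).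
- by rewrite dotp_mulmx.
Qed.

Lemma quadE A B x : A^T = A ->
  quad A B x = 2^-1 * dotp (A *m x) x + (B *m x) 0 0.
Proof. by move=> sA; rewrite dotp_mulmx. Qed.

(** A quadratic is a polynomial of degree 2 along every line. *)
Lemma grad_quad A B x : A^T = A -> grad (quad A B) x = A *m x + B^T.
Proof.
move=> sA; apply/colP => i; rewrite mxE.
set v := delta_mx i 0 : 'cV[R]_d.+1.
have vE (y : 'cV[R]_d.+1) : dotp y v = y i 0.
  rewrite /dotp (bigD1 i)//= mxE !eqxx mulr1 big1 ?addr0// => j /negPf ji.
  by rewrite mxE ji mulr0.
have BE : (B *m v) 0 0 = B 0 i.
  by rewrite -[B]trmxK -dotpE vE !mxE.
pose a := dotp (A *m x) v + (B *m v) 0 0.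
pose b := 2^-1 * dotp (A *m v) v.
pose g (t : R) := quad A B x + t * a + t ^+ 2 * b.
have gE (t : R) : quad A B (t *: v + x) = g t.
  rewrite /g /a /b !quadE// !mulmxDr -!scalemxAr.
  rewrite !(psdDl hd) !(psdDr hd) !(psdZl hd) !(psdZr hd).
  have -> : dotp (A *m v) x = dotp (A *m x) v.
    by rewrite (psd_sym hd) dotpE dotp_mulmx// mulmxA.
  by rewrite !mxE; field.
have Dg : is_derive (0 : R) 1 g a.
  rewrite /g; apply: is_derive_eq.
  by rewrite /GRing.scale/=; ring.
have -> : 'D_v (quad A B) x = 'D_1 g 0.
  have E : (fun h : R => h^-1 *: ((quad A B \o shift x) (h *: v) - quad A B x)) =
      (fun h : R => h^-1 *: ((g \o shift 0) (h *: 1) - g 0)).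
    apply/funext => h /=; rewrite gE addr0 [h *: 1]mulr1; congr (_ *: (_ - _)).
    by rewrite /g mul0r expr0n mul0r !addr0.
  by rewrite /derive E.
by rewrite derive_val /a vE BE !mxE.
Qed.

(** The largest eigenvalue bounds the Rayleigh quotient: a maximizer v of the
    quotient, with value lambda, lies in the kernel of the positive
    semidefinite form of lambda - A, hence is an eigenvector. *)
Lemma rayleigh_le_eigenvalue A l x : A^T = A -> possemidef A ->
  largest_eigenvalue A l -> dotp (A *m x) x <= l * dotp x x.
Proof.
move=> sA pA [_ lmax].
have [v v0 vmax] := psd_rayleigh (psd_mulmx sA pA) hd (@dotp_gt0 R d).
have Nv := dotp_gt0 v0; pose lambda := dotp (A *m v) v / dotp v v.
have ray y : dotp (A *m y) y <= lambda * dotp y y.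
  by rewrite /lambda mulrAC ler_pdivlMr.
have hb : psd_form (fun y z => dotp (lambda *: y - A *m y) z).
  split=> [y z|a y z u|y].
  - rewrite !(psdDl hd) !(psdNl hd) !(psdZl hd) (psd_sym hd y z).
    by rewrite (psd_sym (psd_mulmx sA pA) y z).
  - rewrite mulmxDr -scalemxAr -(psd_linear hd); congr dotp.
    by apply/colP => i; rewrite !mxE; ring.
  - by rewrite (psdDl hd) (psdNl hd) (psdZl hd) subr_ge0.
have eig : lambda *: v - A *m v = 0.
  apply/eqP; apply: contraT => /dotp_gt0.
  rewrite (psd_kernel hb) ?ltxx//.
  by rewrite (psdDl hd) (psdNl hd) (psdZl hd) /lambda divfK ?subrr// gt_eqF.
have /lmax ll : eigenvalue A lambda.
  apply/eigenvalueP; exists v^T; last by rewrite trmx_eq0.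
  rewrite -{1}sA -trmx_mul -linearZ/=; congr trmx.
  by apply/esym/eqP; rewrite -subr_eq0 eig.
by rewrite (le_trans (ray x))// ler_wpM2r// dotp_ge0.
Qed.

Lemma largest_eigenvalue_ge0 A l : A^T = A -> possemidef A ->
  largest_eigenvalue A l -> 0 <= l.
Proof.
move=> sA pA hl; pose v : 'cV[R]_d.+1 := const_mx 1.
have v0 : 0 < dotp v v := dotp_ones_gt0 R d.
rewrite -(pmulr_lge0 _ v0) (le_trans _ (rayleigh_le_eigenvalue v sA pA hl))//.
exact: psd_ge0 (psd_mulmx sA pA) v.
Qed.

(** Cauchy-Schwarz for the form of A, between x and A x. *)
Lemma sqr_mulmx_le A l x : A^T = A -> possemidef A ->
  largest_eigenvalue A l ->
  dotp (A *m x) (A *m x) <= l * dotp (A *m x) x.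
Proof.
move=> sA pA hl; have hA := psd_mulmx sA pA.
have l0 := largest_eigenvalue_ge0 sA pA hl.
have b0 : 0 <= dotp (A *m x) x := psd_ge0 hA x.
have := dotp_ge0 (A *m x); rewrite le_eqVlt => /predU1P[<-|G0].
  by rewrite mulr_ge0.
have := psd_Cauchy_Schwarz hA x (A *m x); rewrite expr2.
move=> /le_trans/(_ (ler_wpM2l b0 (rayleigh_le_eigenvalue _ sA pA hl))).
by rewrite mulrA ler_pM2r// mulrC.
Qed.

(** Strong convexity of the average, at the midpoint 0 of x and - x: on the
    common kernel the quadratics are linear, so their values cancel out. *)
Lemma average_kernel n (A : 'I_n.+1 -> 'M[R]_d.+1) (B : 'I_n.+1 -> 'rV[R]_d.+1)
    (mu : R) x : (forall k, (A k)^T = A k) -> 0 < mu ->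
  strongly_convex mu (average (fun k => quad (A k) (B k))) ->
  (forall k, A k *m x = 0) -> x = 0.
Proof.
move=> sA mu0 cf Ax; apply/eqP; apply: contraT => /dotp_gt0 x0.
have qE k y : A k *m y = 0 -> quad (A k) (B k) y = (B k *m y) 0 0.
  by move=> Ay; rewrite quadE// Ay (psd0l hd) mulr0 add0r.
have aN : average (fun k => quad (A k) (B k)) (- x) =
    - average (fun k => quad (A k) (B k)) x.
  rewrite /average -mulrN -sumrN; congr (_ * _); apply: eq_bigr => k _.
  by rewrite !qE ?mulmxN ?Ax ?oppr0// mxE.
have a0 : average (fun k => quad (A k) (B k)) 0 = 0.
  by rewrite /average big1 ?mulr0// => k _; rewrite qE ?mulmx0// mxE.
have := cf x (- x) 2^-1.
have -> : 2^-1 *: x + (1 - 2^-1) *: - x = 0.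
  by apply/colP => i; rewrite !mxE; field.
have -> : x - - x = 2 *: x by rewrite opprK scaler_nat mulr2n.
rewrite a0 aN sqr_enorm (psd_sq hd).
rewrite invr_ge0 ler0n invf_le1// ler1n => /(_ isT); nra.
Qed.

End Quadratic.

Lemma eq_from_col (R : realType) m n (A B : 'M[R]_(m, n)) :
  (forall j, col j A = col j B) -> A = B.
Proof.
by move=> AB; apply/matrixP => i j; have /colP/(_ i) := AB j; rewrite !mxE.
Qed.

(** * The two contraction estimates *)

Section Cases.
Variables (R : realType) (n d : nat) (E : rel 'I_n.+1).
Variables (W : 'M[R]_n.+1) (pi : 'cV[R]_n.+1).
Hypotheses (hE : strongly_connected E) (hW : mixing_matrix E W).
Hypothesis hpi : stationary W pi.

Let pi_gt0 := stationary_gt0 hE hW hpi.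
Let npi_gt0 j : 0 < n.+1%:R * pi j 0.
Proof. by rewrite mulr_gt0. Qed.

Lemma strongly_convex_case (f : 'I_n.+1 -> 'cV[R]_d.+1 -> R)
    (mu L : 'I_n.+1 -> R) :
  (forall k, 0 < mu k) ->
  (forall k, strongly_convex (mu k) (f k)) ->
  (forall k, smooth (L k) (f k)) ->
  let alpha0 := min_ord (fun k => 2 * n.+1%:R * pi k 0 / (L k + mu k)) in
  let C := min_ord (fun k =>
    mu k * L k / (n.+1%:R * (mu k + L k) * pi k 0)) in
  unique_fixed_points (Tstep W pi f) alpha0 /\
  fixed_points_bounded pi (Tstep W pi f) alpha0
    (C^-1 * wnorm pi (mix W (gradF f 0))).
Proof.
move=> mu0 cf sf alpha0 C.
have L0 k : 0 < L k.
  exact: lt_le_trans (mu0 k) (strongly_convex_smooth_le (cf k) (sf k)).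
have a0_le a k : 0 < a <= alpha0 ->
    0 < a <= 2 * (n.+1%:R * pi k 0) / (L k + mu k).
  by move=> /andP[-> /le_trans]; apply; rewrite mulrA; exact: min_ord_le.
have C_le k : C <= mu k * L k / (n.+1%:R * pi k 0 * (mu k + L k)).
  by rewrite [X in _ / X]mulrAC; exact: min_ord_le.
have C0 : 0 < C.
  by apply: min_ord_gt0 => k; rewrite divr_gt0 ?mulr_gt0 ?addr_gt0.
apply: (contractive_family hE hW hpi C0) => a a0.
have a_gt0 : 0 < a by case/andP: a0.
have aC k : a * C <= a * (mu k * L k / (n.+1%:R * pi k 0 * (mu k + L k))).
  by rewrite ler_pM2l.
have step k :=
  gradient_step_contraction (mu0 k) (npi_gt0 k) (cf k) (sf k) (a0_le a k a0).
have aC1 : a * C <= 1 by case: (step ord0) => _ + _; apply: le_trans.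
split=> //; apply: (Tstep_lipschitz hE hW hpi); first by rewrite subr_ge0.
move=> j w z; case: (step j) => _ _ /(_ (col j w) (col j z)) hj.
rewrite local_stepB (le_trans hj)// [col j (w - z)]linearB/=.
rewrite ler_wpM2r ?enorm_ge0//.
by rewrite lerD2l lerN2.
Qed.

(** T_alpha is a barycentre of the pure mixing step and of T_{alpha0}. *)
Lemma Tstep_convex (f : 'I_n.+1 -> 'cV[R]_d.+1 -> R) (t a0 : R) w :
  Tstep W pi f (t * a0) w = (1 - t) *: mix W w + t *: Tstep W pi f a0 w.
Proof.
rewrite !TstepE -mixZ -mix_linear; congr mix; apply/matrixP => i j.
by rewrite !mxE; ring.
Qed.

Section QuadraticCase.
Variables (A : 'I_n.+1 -> 'M[R]_d.+1) (B : 'I_n.+1 -> 'rV[R]_d.+1).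
Variables (mu epsilon : R) (L : 'I_n.+1 -> R).
Let f k := quad (A k) (B k).
Hypothesis sA : forall k, (A k)^T = A k.
Hypothesis pA : forall k, possemidef (A k).
Hypotheses (mu0 : 0 < mu) (cf : strongly_convex mu (average f)).
Hypothesis hL : forall k, largest_eigenvalue (A k) (L k).
Hypothesis eps0 : 0 < epsilon.
Let alpha0 := min_ord (fun k => 2 * n.+1%:R * pi k 0 / (L k + epsilon)).

Let L0 k : 0 <= L k := largest_eigenvalue_ge0 (sA k) (pA k) (hL k).

Let alpha0_gt0 : 0 < alpha0.
Proof.
by apply: min_ord_gt0 => k; rewrite divr_gt0 ?mulr_gt0// ltr_wpDl.
Qed.

(** The linear part of the gradient steps at alpha0: agent k makes a step of
    size sz k, because its gradient is taken at w_k / (n pi_k). *)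
Let sz k := alpha0 / (n.+1%:R * pi k 0).
Let damp (w : 'M[R]_(d.+1, n.+1)) : 'M[R]_(d.+1, n.+1) :=
  \matrix_(i, j) (col j w - sz j *: (A j *m col j w)) i 0.

Let sz_gt0 k : 0 < sz k.
Proof. by rewrite divr_gt0. Qed.

Let sz_lt2 k : sz k * L k < 2.
Proof.
have Le : 0 < L k + epsilon by rewrite ltr_wpDl.
have : sz k * (L k + epsilon) <= 2.
  rewrite /sz mulrAC ler_pdivrMr// -ler_pdivlMr// mulrA.
  exact: min_ord_le.
by apply: lt_le_trans; rewrite ltr_pM2l// ltrDl.
Qed.

Let col_damp j w : col j (damp w) = col j w - sz j *: (A j *m col j w).
Proof. by apply/colP => i; rewrite [LHS]mxE mxE. Qed.

Let damp_linear a w z : damp (a *: w + z) = a *: damp w + damp z.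
Proof.
apply: eq_from_col => j.
rewrite linearP/= !col_damp linearP/= mulmxDr -scalemxAr.
by apply/colP => i; rewrite !mxE; ring.
Qed.

Let local_step_affine w z :
  local_step pi f alpha0 w - local_step pi f alpha0 z = damp (w - z).
Proof.
apply: eq_from_col => j; rewrite local_stepB col_damp [col j (w - z)]linearB/=.
rewrite !grad_quad//; congr (_ - _); rewrite opprD addrACA subrr addr0.
by rewrite -mulmxBr -scalerBr -scalemxAr scalerA.
Qed.

(** The loss in a gradient step of size s is at least s (2 - s L) <A w, w>. *)
Let damp_le w : wdot pi (damp w) (damp w) + \sum_j (pi j 0)^-1 *
    (sz j * (2 - sz j * L j) * dotp (A j *m col j w) (col j w))
  <= wdot pi w w.
Proof.
pose hd := @psd_dotp R d.
rewrite /wdot -big_split/=; apply: ler_sum => j _; rewrite -mulrDr.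
rewrite ler_pM2l ?invr_gt0// col_damp (psdBsq hd) (psd_sq hd) (psdZr hd).
rewrite (psd_sym hd (col j w)).
have := sqr_mulmx_le (col j w) (sA j) (pA j) (hL j).
by have := sqr_ge0 (sz j); nra.
Qed.

Let defect_ge0 w k : 0 <= (pi k 0)^-1 *
  (sz k * (2 - sz k * L k) * dotp (A k *m col k w) (col k w)).
Proof.
have b0 : 0 <= dotp (A k *m col k w) (col k w).
  exact: psd_ge0 (psd_mulmx (sA k) (pA k)) _.
have s2 : 0 <= 2 - sz k * L k by rewrite subr_ge0 ltW.
have p0 : 0 <= (pi k 0)^-1 by rewrite invr_ge0 ltW.
exact: mulr_ge0 p0 (mulr_ge0 (mulr_ge0 (ltW (sz_gt0 k)) s2) b0).
Qed.

Let dampI_le w : wdot pi w w <= wdot pi (damp w) (damp w) ->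
  forall j, A j *m col j w = 0.
Proof.
move=> wl j; apply/eqP; apply: contraT => /dotp_gt0.
have S0 : \sum_k (pi k 0)^-1 *
    (sz k * (2 - sz k * L k) * dotp (A k *m col k w) (col k w)) = 0.
  apply/eqP; rewrite eq_le sumr_ge0 ?andbT//.
  by have := damp_le w; lra.
have /(_ j isT)/eqP := psumr_eq0P (fun k _ => defect_ge0 w k) S0.
have s2 : 0 < 2 - sz j * L j by rewrite subr_gt0.
rewrite mulf_eq0 invr_eq0 (gt_eqF (pi_gt0 j)) mulf_eq0 mulf_eq0.
rewrite (gt_eqF (sz_gt0 j)) (gt_eqF s2).
move=> /eqP bj0; have := sqr_mulmx_le (col j w) (sA j) (pA j) (hL j).
by rewrite bj0 mulr0 leNgt => /negPf ->.
Qed.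

(** A vector whose norm is preserved has blocks pi_j u, with u in the kernel of
    all the A_j, hence vanishes. *)
Let mix_damp_lt w : w != 0 ->
  wdot pi (mix W (damp w)) (mix W (damp w)) < wdot pi w w.
Proof.
move=> w0; have le1 := wdot_mix_le hE hW hpi (damp w).
have le2 : wdot pi (damp w) (damp w) <= wdot pi w w.
  apply: le_trans (damp_le w); rewrite lerDl.
  by apply: sumr_ge0 => k _; exact: defect_ge0.
rewrite lt_neqAle (le_trans le1 le2) andbT; apply: contra w0 => /eqP eq1.
have Aw : forall j, A j *m col j w = 0.
  by apply: dampI_le; rewrite -eq1.
have dw : damp w = w.
  by apply: eq_from_col => j; rewrite col_damp Aw scaler0 subr0.
rewrite dw in eq1; have cons := mix_isometric_consensus hE hW hpi eq1.
pose u := (pi 0 0)^-1 *: col 0 w.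
have wu j : col j w = pi j 0 *: u.
  apply/colP => i; rewrite !mxE [_^-1 * _]mulrC -(cons i j).
  by rewrite mulrC divfK// gt_eqF.
have u0 : u = 0.
  apply: (average_kernel sA mu0 cf) => k; apply/eqP.
  have /eqP := Aw k; rewrite wu -scalemxAr scaler_eq0.
  by rewrite gt_eqF.
by apply/eqP; apply: eq_from_col => j; rewrite wu u0 scaler0 col0.
Qed.

Lemma quadratic_contraction :
  exists eta, contraction_constant pi (Tstep W pi f alpha0) eta.
Proof.
have pi1 := stationary_le1 hE hW hpi.
have hw := psd_wdot d pi_gt0.
have gl a w z : mix W (damp (a *: w + z)) =
    a *: mix W (damp w) + mix W (damp z).
  by rewrite damp_linear mix_linear.
have [v v0 vmax] := psd_rayleigh (psd_form_comp gl hw) hw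
  (@wdot_gt0 _ _ _ _ pi_gt0 pi1).
have Nv := wdot_gt0 pi_gt0 pi1 v0.
pose rho := wdot pi (mix W (damp v)) (mix W (damp v)) / wdot pi v v.
have rho0 : 0 <= rho by rewrite divr_ge0 ?(ltW Nv)// (psd_ge0 hw).
have rho1 : rho < 1 by rewrite ltr_pdivrMr// mul1r mix_damp_lt.
have ray w : wdot pi (mix W (damp w)) (mix W (damp w)) <= rho * wdot pi w w.
  by rewrite /rho mulrAC ler_pdivlMr// vmax.
(* a contraction constant is positive but rho may vanish, so take the midpoint *)
pose s := (rho + 1) / 2.
have s0 : 0 < s by rewrite divr_gt0// ltr_wpDl.
have s1 : s < 1 by rewrite /s; lra.
exists (Num.sqrt s); split.
  by rewrite sqrtr_gt0 s0 -[X in _ < X]sqrtr1 ltr_sqrt.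
move=> w z; rewrite !TstepE -mixB local_step_affine !wnormE -sqrtrM ?(ltW s0)//.
apply: ler_wsqrtr; rewrite (le_trans (ray _))// ler_wpM2r ?(psd_ge0 hw)//.
by rewrite /s; lra.
Qed.

Lemma quadratic_family eta :
  contraction_constant pi (Tstep W pi f alpha0) eta ->
  unique_fixed_points (Tstep W pi f) alpha0 /\
  fixed_points_bounded pi (Tstep W pi f) alpha0
    (((1 - eta) / alpha0)^-1 * wnorm pi (mix W (gradF f 0))).
Proof.
move=> [/andP[eta0 eta1] heta].
have C0 : 0 < (1 - eta) / alpha0 by rewrite divr_gt0 ?subr_gt0.
apply: (contractive_family hE hW hpi C0) => a /andP[a0 aa0].
pose t := a / alpha0.
have t0 : 0 < t by rewrite divr_gt0.
have t1 : t <= 1 by rewrite ler_pdivrMr// mul1r.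
have -> : a * ((1 - eta) / alpha0) = t * (1 - eta).
  by rewrite /t mulrA mulrAC.
split=> [|w z]; first by nra.
have aE : a = t * alpha0 by rewrite /t divfK// gt_eqF.
have -> : Tstep W pi f a w - Tstep W pi f a z = (1 - t) *: mix W (w - z) +
    t *: (Tstep W pi f alpha0 w - Tstep W pi f alpha0 z).
  by rewrite aE !Tstep_convex mixB !scalerBr opprD addrACA.
rewrite (le_trans (wnormD pi_gt0 _ _))// !(wnormZ pi_gt0).
rewrite (gtr0_norm t0) ger0_norm ?subr_ge0//.
have t1' : 0 <= 1 - t by rewrite subr_ge0.
have h1 := ler_wpM2l t1' (wnorm_mix_le hE hW hpi (w - z)).
have h2 := ler_wpM2l (ltW t0) (heta w z).
rewrite (le_trans (lerD h1 h2))// mulrA -mulrDl.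
by have -> : 1 - t + t * eta = 1 - t * (1 - eta) by ring.
Qed.

End QuadraticCase.

End Cases.

Theorem theorem2p4 (R : realType) (n d : nat) (E : rel 'I_n.+1)
    (W : 'M[R]_n.+1) (pi : 'cV[R]_n.+1)
    (hE : strongly_connected E) (hW : mixing_matrix E W)
    (hpi : stationary W pi) :
  (* Case 1 *)
  (forall (f : 'I_n.+1 -> 'cV[R]_d.+1 -> R) (mu L : 'I_n.+1 -> R),
    (forall k, 0 < mu k) ->
    (forall k, strongly_convex (mu k) (f k)) ->
    (forall k, smooth (L k) (f k)) ->
    let alpha0 := min_ord (fun k => 2 * n.+1%:R * pi k 0 / (L k + mu k)) in
    let C := min_ord (fun k =>
      mu k * L k / (n.+1%:R * (mu k + L k) * pi k 0)) in
    unique_fixed_points (Tstep W pi f) alpha0 /\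
    fixed_points_bounded pi (Tstep W pi f) alpha0
      (C^-1 * wnorm pi (mix W (gradF f 0)))) /\
  (* Case 2 *)
  (forall (A : 'I_n.+1 -> 'M[R]_d.+1) (B : 'I_n.+1 -> 'rV[R]_d.+1)
     (mu epsilon : R) (L : 'I_n.+1 -> R),
    let f := fun k => quad (A k) (B k) in
    (forall k, (A k)^T = A k) ->
    (forall k, possemidef (A k)) ->
    0 < mu ->
    strongly_convex mu (average f) ->
    (forall k, largest_eigenvalue (A k) (L k)) ->
    0 < epsilon ->
    let alpha0 := min_ord (fun k => 2 * n.+1%:R * pi k 0 / (L k + epsilon)) in
    [/\ unique_fixed_points (Tstep W pi f) alpha0,
        (exists eta, contraction_constant pi (Tstep W pi f alpha0) eta)
      & forall eta, contraction_constant pi (Tstep W pi f alpha0) eta ->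
          let C := (1 - eta) / alpha0 in
          fixed_points_bounded pi (Tstep W pi f) alpha0
            (C^-1 * wnorm pi (mix W (gradF f 0)))]).
Proof.
split=> [f mu L mu0 cf sf|A B mu epsilon L f sA pA mu0 cf hL eps0 alpha0].
  exact (strongly_convex_case hE hW hpi mu0 cf sf).
have family := quadratic_family hE hW hpi sA pA hL eps0.
have contr := quadratic_contraction hE hW hpi sA pA mu0 cf hL eps0.
split=> //; first by case: contr => eta /family[].
by move=> eta /family[].
Qed.
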